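(* Let $n \ge 2$ be an integer and let $Q(x) = x^n + a_1 x^{n-1} + \cdots + a_{n-1}x + a_n = \prod_{i=1}^{n}(x - x_i)$ be a monic polynomial of degree $n$ all of whose roots $x_1,\dots,x_n$ (listed with multiplicity) are nonzero integers. Suppose that for some $j \in \{1,\dots,n-1\}$ and some real number $M$ we have $\max(|a_j|,|a_{j+1}|) \le M$. Then $$\max(|x_1|,\dots,|x_n|) \le \alpha_n M,$$ where $\alpha_2 = 1$, $\alpha_3 = 2^{1/2}$, $\alpha_4 = 3\cdot 2^{1/2}$, $\alpha_5 = 15\cdot 2^{1/2}$, and $\alpha_n = 2^{\frac{n^2+2n-18}{4}}$ for $n \ge 6$.
   Context: $\mathbb{Z}^*$ denotes the set of nonzero integers; the polynomials considered are monic of degree $n$ with integer coefficients $a_1,\dots,a_n$ (with $a_0 = 1$ the leading coefficient) whose roots all lie in $\mathbb{Z}^*$. *)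

(* Defs.v *)
From HB Require Import structures.
From mathcomp Require Import all_boot all_order all_algebra.
From mathcomp Require Import all_reals exp.

Set Implicit Arguments.
Unset Strict Implicit.
Unset Printing Implicit Defensive.

Import Order.TTheory GRing.Theory Num.Theory.

Local Open Scope ring_scope.

(* Only the values at n >= 2 are meaningful; 0 and 1 fall into the last case. *)
Definition alpha (R : realType) (n : nat) : R :=
  match n with
  | 2 => 1
  | 3 => 2 `^ (1 / 2)
  | 4 => 3 * (2 `^ (1 / 2))
  | 5 => 15 * (2 `^ (1 / 2))
  | _ => 2 `^ ((n%:R ^+ 2 + 2 * n%:R - 18) / 4)
  end.

(* Main.v *)
(* Write e_k(A) for the k-th elementary symmetric function of the roots indexed
   by A, and D_k = e_k^2 - e_(k-1) e_(k+1). The identity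
     (k+1) D_k(A) = e_k(A)^2 + sum_(i in A) x_i^2 D_(k-1)(A \ i)
   gives, by induction, (k+1) D_k >= e_k(x_1^2, ..., x_n^2). If P is the largest
   |product| of j roots, then |x_i| <= P (all |x_i| >= 1), P^2 <= e_j(x^2) and
   |e_(j-1)| <= C(n,j-1) P, so P^2 <= (j+1) (M^2 + C(n,j-1) P M), whence
   |x_i| <= ((j+1) C(n,j-1) + 1) M. This suffices except when j = n-1, which is
   trivial since |e_n| <= M, and possibly when j = n-2. In the latter case
     e_(n-1)(x^2) = e_(n-1)^2 - 2 e_n e_(n-2) <= M^2 + 2 |e_n| M,
   while AM-GM on two of its terms bounds the left side below by 2 |e_n| |x_i|;
   as |e_n| >= |x_i|, this yields |x_i| <= 7/5 M. *)
Require Import Defs.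
From HB Require Import structures.
From mathcomp Require Import all_boot all_order all_algebra.
From mathcomp Require Import all_reals exp.
From mathcomp Require Import zify ring lra.

Set Implicit Arguments.
Unset Strict Implicit.
Unset Printing Implicit Defensive.

Import Order.TTheory GRing.Theory Num.Theory.

Local Open Scope ring_scope.

(** * Elementary symmetric functions through a generating polynomial *)

Lemma setD1_ind (T : finType) (P : {set T} -> Prop) :
  P set0 -> (forall (A : {set T}) i, i \in A -> P (A :\ i) -> P A) -> forall A, P A.
Proof.
move=> P0 PD1 A; have [m] := ubnP #|A|; elim: m A => // m IHm A cA.
have [-> //|[i iA]] := set_0Vmem A; apply: (PD1 A i iA); apply: IHm.
by rewrite (cardsD1 i) iA in cA.
Qed.

(** The coefficient of index k is e_k(A). Unlike in the polynomial with roots x_i, the index does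
    not depend on the size of A, so deleting a root just drops a factor. *)
Definition esym_gen (R : comNzRingType) (I : finType) (x : I -> R)
    (A : {set I}) : {poly R} :=
  \prod_(i in A) (1 + x i *: 'X).

Section ElementarySymmetric.

Variables (R : comNzRingType) (I : finType).
Implicit Types (x : I -> R) (A : {set I}) (p : {poly R}).

Lemma coef_mul_1addZX p c k :
  ((1 + c *: 'X) * p)`_k = p`_k + c * ('X * p)`_k.
Proof. by rewrite mulrDl mul1r -scalerAl coefD coefZ. Qed.

Lemma coefXMS p k : ('X * p)`_k.+1 = p`_k.
Proof. by rewrite coefXM. Qed.

Lemma esym_genD1 x A i : i \in A ->
  esym_gen x A = (1 + x i *: 'X) * esym_gen x (A :\ i).
Proof. exact: big_setD1. Qed.

Lemma esym_gen0 x : esym_gen x set0 = 1.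
Proof. exact: big_set0. Qed.

Lemma esym_gen_coef0 x A : (esym_gen x A)`_0 = 1.
Proof.
rewrite coef0_prod big1 // => i _.
by rewrite coefD coef1 coefZ coefX mulr0 addr0.
Qed.

Lemma esym_gen_sum x :
  esym_gen x setT = \sum_(B : {set I}) (\prod_(i in B) x i) *: 'X^#|B|.
Proof.
rewrite /esym_gen (eq_bigl xpredT) => [|i]; last by rewrite inE.
under eq_bigr do rewrite addrC.
rewrite bigA_distr; apply: eq_bigr => B _.
rewrite -big_mkcond /= scaler_prod.
by rewrite prodr_const.
Qed.

Lemma esym_gen_coef x k :
  (esym_gen x setT)`_k = \sum_(B : {set I} | #|B| == k) \prod_(i in B) x i.
Proof. by rewrite esym_gen_sum coef_sumMXn. Qed.

(** Vieta's formulas: in the expansion, the set B of factors contributing [- x i] yields a monomial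
    of degree [#|I| - #|B|]. *)
Lemma coef_prod_linear_factors x k : (k <= #|I|)%N ->
  (\prod_(i : I) ('X - (x i)%:P))`_(#|I| - k) =
    (-1) ^+ k * (esym_gen x setT)`_k.
Proof.
move=> lekn; rewrite esym_gen_coef mulr_sumr.
under eq_bigr do rewrite addrC -polyCN.
rewrite bigA_distr (eq_bigr
  (fun B : {set I} => (\prod_(i in B) (- x i)) *: 'X^(#|I| - #|B|))) => [|B _].
  rewrite coef_sumMXn; apply: eq_big => [B|B /eqP cB].
    rewrite inE; have := max_card B; move: #|B| #|I| lekn => b m; lia.
  rewrite prodrN; congr (_ ^+ _ * _).
  have := max_card B; move: #|B| #|I| lekn cB => b m; lia.
rewrite -mul_polyC rmorph_prod /= (bigID (mem B)) /=; congr (_ * _).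
  by apply: eq_bigr => i ->.
under eq_bigr => i /negbTE -> do [].
rewrite prodr_const -[X in (X - _)%N](cardC B) addKn.
by congr ('X^_).
Qed.

(** By the product rule, differentiating the generating polynomial drops one factor at a time. *)
Lemma sum_mul_esym_genD1 x A k :
  \sum_(i in A) x i * (esym_gen x (A :\ i))`_k = (esym_gen x A)`_k.+1 *+ k.+1.
Proof.
rewrite -coef_deriv.
suff -> : (esym_gen x A)^`() = \sum_(i in A) x i *: esym_gen x (A :\ i).
  by rewrite coef_sum; apply: eq_bigr => i _; rewrite coefZ.
elim/setD1_ind: A => [|A z zA IHA].
  by rewrite esym_gen0 big_set0 derivE.
rewrite (esym_genD1 _ zA) derivM derivD derivZ derivX derivC add0r IHA.
rewrite (big_setD1 z zA) /= -scalerAl mul1r; congr (_ + _).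
rewrite mulr_sumr; apply: eq_bigr => i; rewrite !inE => /andP[iz iA].
rewrite -scalerAr; congr (_ *: _).
rewrite (@esym_genD1 _ (A :\ i) z) ?inE ?zA 1?eq_sym ?iz //.
by congr (_ * esym_gen x _); apply/setP => l; rewrite !inE andbCA.
Qed.

Lemma esym_gen_coef_gt_card x A k : (#|A| < k)%N -> (esym_gen x A)`_k = 0.
Proof.
elim/setD1_ind: A k => [|A z zA IHA] [|k] //.
  by rewrite esym_gen0 coef1.
rewrite (esym_genD1 _ zA) coef_mul_1addZX coefXMS (cardsD1 z) zA ltnS => lt_k.
by rewrite !IHA ?mulr0 ?addr0 // ltnW.
Qed.

Lemma esym_gen_coef_card x A : (esym_gen x A)`_#|A| = \prod_(i in A) x i.
Proof.
elim/setD1_ind: A => [|A z zA IHA].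
  by rewrite cards0 esym_gen0 big_set0 coef1.
rewrite (esym_genD1 _ zA) coef_mul_1addZX (cardsD1 z) zA coefXMS IHA.
by rewrite esym_gen_coef_gt_card // add0r -big_setD1.
Qed.

(* Multiplying by 'X shifts indices: ('X * p)`_k is p`_(k-1), and 0 at k = 0. *)
Definition newton_gap x A k : R :=
  let p := esym_gen x A in p`_k ^+ 2 - ('X * p)`_k * p`_k.+1.

Lemma newton_gapS x A k :
  newton_gap x A k.+1 *+ k.+2 = (esym_gen x A)`_k.+1 ^+ 2
    + \sum_(i in A) x i ^+ 2 * newton_gap x (A :\ i) k.
Proof.
set p := esym_gen x A.
(* Let q be the polynomial of A \ i. Since p = (1 + x_i X) q, the q_k q_(k+1) terms cancel in x_i^2
   D_k(A \ i) = p_(k+1) x_i q_k - p_k x_i q_(k+1). This is linear in q, so the derivative identity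
   sums it. *)
rewrite (eq_bigr (fun i => p`_k.+1 * (x i * (esym_gen x (A :\ i))`_k)
   - p`_k * (x i * (esym_gen x (A :\ i))`_k.+1))) => [|i iA]; last first.
  rewrite /newton_gap /p (esym_genD1 x iA) !coef_mul_1addZX !coefXMS.
  ring.
rewrite sumrB -!mulr_sumr !sum_mul_esym_genD1 -/p /newton_gap -/p coefXMS.
ring.
Qed.

(** The shifts by ['X] make e_(n-1) and e_(n-2), with n the size of A, read 0 at negative indices,
    so the induction can start at the empty set. *)
Lemma esym_gen_sqr_subtop x A :
  let p := esym_gen x A in
  ('X * esym_gen (fun i => x i ^+ 2) A)`_#|A| =
    ('X * p)`_#|A| ^+ 2 - 2 * p`_#|A| * ('X * ('X * p))`_#|A|.
Proof.
move=> /=; elim/setD1_ind: A => [|A z zA IHA].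
  by rewrite cards0 !coefXM /=; ring.
rewrite (cardsD1 z) zA add1n !coefXMS !(esym_genD1 _ zA) !coef_mul_1addZX.
rewrite !coefXMS IHA (@esym_gen_coef_gt_card x _ _.+1) // !esym_gen_coef_card prodrXl.
rewrite (mulrCA 'X (1 + _)) coef_mul_1addZX.
ring.
Qed.

End ElementarySymmetric.

(** * Bounds on a root from two consecutive coefficients *)

Section RealRoots.

Variables (R : realDomainType) (I : finType) (x : I -> R).
Implicit Types (A B C : {set I}).

Let sq i := x i ^+ 2.

Lemma newton_gap_ge A k :
  (esym_gen sq A)`_k <= newton_gap x A k *+ k.+1.
Proof.
elim: k A => [|k IHk] A.
  by rewrite /newton_gap !esym_gen_coef0 coefXM /= mul0r subr0 expr1n.
(* Scaled by k+1, the left side expands by the derivative identity for the squares over the same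
   sets A \ i as in [newton_gapS]. *)
rewrite -(ler_pMn2r (ltn0Sn k)) -sum_mul_esym_genD1.
apply: le_trans (_ : (\sum_(i in A) x i ^+ 2 * newton_gap x (A :\ i) k) *+ k.+1 <= _).
  rewrite -sumrMnl; apply: ler_sum => i _.
  by rewrite -mulrnAr ler_wpM2l ?sqr_ge0.
by rewrite ler_pMn2r // newton_gapS lerDr sqr_ge0.
Qed.

Lemma sqr_prod_le_esym_gen B :
  (\prod_(i in B) x i) ^+ 2 <= (esym_gen sq setT)`_#|B|.
Proof.
rewrite esym_gen_coef (bigD1 B) //= -prodrXl lerDl sumr_ge0 // => C _.
by apply: prodr_ge0 => i _; apply: sqr_ge0.
Qed.

(** Adding an index never decreases the absolute product, so C can be enlarged to size k. *)
Lemma normr_prod_le_superset (P : R) k C : (forall i, 1 <= `|x i|) ->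
  (forall B, #|B| = k -> `|\prod_(i in B) x i| <= P) ->
  (#|C| <= k <= #|I|)%N -> `|\prod_(i in C) x i| <= P.
Proof.
move=> x1 leP /andP[leCk lekn]; have [m] := ubnP (k - #|C|).
elim: m C leCk => // m IHm C leCk lt_m.
have [/eqP/leP //|neqCk] := boolP (#|C| == k).
have /set0Pn[i iC] : ~: C != set0.
  by rewrite -card_gt0 cardsCs setCK; move: leCk neqCk lekn; lia.
rewrite inE in iC.
apply: (le_trans _ (IHm (i |: C) _ _)); rewrite ?cardsU1 ?iC; try lia.
by rewrite big_setU1 //= normrM ler_peMl.
Qed.

Lemma prod_norm_ge1 (P : pred I) : (forall i, 1 <= `|x i|) ->
  1 <= \prod_(i | P i) `|x i|.
Proof. by move=> x1; elim/big_ind: _ => // a b; apply: mulr_ege1. Qed.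

Lemma root_le_binomial k (M : R) i0 : (forall i, 1 <= `|x i|) ->
  (k < #|I|)%N ->
  `|(esym_gen x setT)`_k.+1| <= M -> `|(esym_gen x setT)`_k.+2| <= M ->
  `|x i0| <= (k.+2 * 'C(#|I|, k)).+1%:R * M.
Proof.
move=> x1 ltkn e1M e2M.
have [B0 B0k] : exists B0 : {set I}, #|B0| == k.+1.
  have : (0 < #|[set B : {set I} | #|B| == k.+1]|)%N by rewrite card_draws bin_gt0.
  by case/card_gt0P => B; rewrite inE; exists B.
have [B /eqP Bk maxB] :=
  @arg_maxP _ _ _ B0 (fun B => #|B| == k.+1) (fun B => `|\prod_(i in B) x i|) B0k.
set P := `|_| in maxB.
have leP C : (#|C| <= k.+1)%N -> `|\prod_(i in C) x i| <= P.
  move=> Ck; apply: (@normr_prod_le_superset _ k.+1) => // [D /eqP/maxB //|].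
  by rewrite Ck.
have x0P : `|x i0| <= P by have := leP [set i0]; rewrite big_set1 cards1; apply.
have P1 := le_trans (x1 i0) x0P; apply: le_trans x0P _.
have e0P : `|(esym_gen x setT)`_k| <= 'C(#|I|, k)%:R * P.
  rewrite esym_gen_coef; apply: le_trans (ler_norm_sum _ _ _) _.
  apply: (@le_trans _ _ (\sum_(C : {set I} | #|C| == k) P)).
    by apply: ler_sum => C /eqP Ck; rewrite leP ?Ck.
  rewrite sumr_const mulr_natl -card_draws -cardsE.
  by rewrite (@eq_card _ _ [set A : {set I} | #|A| == k]) // => A; rewrite !inE.
have PP : P ^+ 2 <= (M ^+ 2 + 'C(#|I|, k)%:R * P * M) *+ k.+2.
  rewrite /P real_normK ?num_real //; apply: le_trans (sqr_prod_le_esym_gen B) _.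
  rewrite Bk; apply: le_trans (newton_gap_ge _ _) _.
  rewrite lerMn2r /= /newton_gap coefXMS lerD //.
    by rewrite -real_normK ?num_real // lerXn2r ?nnegrE // (le_trans _ e1M).
  apply: le_trans (ler_norm _) _; rewrite normrN normrM.
  by apply: ler_pM.
(* Let u = k+2 and c be the binomial. If P > (u c + 1) M, then P^2 <= u M^2 + u c M P forces M P < u
   M^2, whereas M P >= (u c + 1) M^2 >= u M^2 because c >= 1. *)
rewrite leNgt; apply/negP => ltP.
have M0 : 0 <= M by apply: le_trans e1M.
have C1 : 1 <= 'C(#|I|, k)%:R :> R by rewrite ler1n bin_gt0 ltnW.
move: PP ltP; rewrite -mulr_natl -(natr1 (_ * _)) natrM.
have : 0 <= k.+2%:R :> R by [].
move: k.+2%:R 'C(#|I|, k)%:R C1 P1 => u c c1; move: (P) => p p1 u0 PP ltP.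
have : 0 <= u * c * M by rewrite !mulr_ge0 //; lra.
have : (u * c + 1) * M * p < p * p by rewrite ltr_pM2r //; lra.
have : 0 <= M * (p - (u * c + 1) * M) by rewrite mulr_ge0 //; lra.
have : 0 <= u * (c - 1) * M ^+ 2 by rewrite !mulr_ge0 // ?sqr_ge0 //; lra.
have := sqr_ge0 M.
nra.
Qed.

Lemma root_le_top (M : R) i0 : (forall i, 1 <= `|x i|) ->
  `|(esym_gen x setT)`_#|I| | <= M -> `|x i0| <= M.
Proof.
move=> x1; rewrite -cardsT esym_gen_coef_card; apply: le_trans.
by rewrite (bigD1 i0) //= normrM ler_peMr // normr_prod prod_norm_ge1.
Qed.

Lemma root_le_subtop (M : R) i0 k : (forall i, 1 <= `|x i|) ->
  #|I| = k.+3 ->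
  `|(esym_gen x setT)`_k.+1| <= M -> `|(esym_gen x setT)`_k.+2| <= M ->
  5 * `|x i0| <= 7 * M.
Proof.
move=> x1 cI e1M e2M.
have /card_gt1P[i [l [iN lN neq_il]]] : (1 < #|~: [set i0]|)%N.
  by rewrite cardsC1 cI.
rewrite !inE in iN lN.
set N := `|(esym_gen x setT)`_k.+3|.
have NE : N = `|\prod_(r : I) x r|.
  rewrite /N -cI -cardsT esym_gen_coef_card.
  by congr `|_|; apply: eq_bigl => r; rewrite inE.
have Nx0 : `|x i0| <= N by apply: root_le_top; rewrite // /N cI.
(* Keep only the two terms omitting i and l. With c the absolute product of the other roots, they
   are (|x_l| c)^2 and (|x_i| c)^2, with sum at least 2 N c; and c >= |x_i0| since i0 differs from i
   and l. *)
have amgm : 2 * (N * `|x i0|) <= (esym_gen sq setT)`_k.+2.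
  rewrite esym_gen_coef (bigD1 (~: [set i])) /=; last by rewrite cardsC1 cI.
  rewrite (bigD1 (~: [set l])) /=; last first.
    rewrite cardsC1 cI eqxx /=; apply: contra neq_il => /eqP/setC_inj/set1_inj ->//.
  rewrite !addrA -[leLHS]addr0; apply: lerD; last first.
    by apply: sumr_ge0 => C _; apply: prodr_ge0 => r _; apply: sqr_ge0.
  pose c := \prod_(r | (r != i) && (r != l)) `|x r|.
  have x0c : `|x i0| <= c.
    rewrite /c (bigD1 i0) /=; last by rewrite ![i0 == _]eq_sym iN lN.
    by rewrite ler_peMr // prod_norm_ge1.
  have -> : N = `|x i| * (`|x l| * c).
    by rewrite NE normr_prod (bigD1 i) //= (bigD1 l) 1?eq_sym.
  have prodC (r s : I) : r != s ->
      \prod_(t in ~: [set r]) sq t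
        = (`|x s| * \prod_(t | (t != r) && (t != s)) `|x t|) ^+ 2.
    move=> rs; rewrite /sq prodrXl -[LHS]real_normK ?num_real //.
    rewrite normr_prod (bigD1 s) ?inE 1?eq_sym //=.
    by congr ((_ * _) ^+ 2); apply: eq_bigl => t; rewrite !inE.
  rewrite (prodC i l) // (prodC l i) 1?eq_sym // -/c.
  have -> : \prod_(t | (t != l) && (t != i)) `|x t| = c.
    by apply: eq_bigl => t; apply: andbC.
  have := x1 i; have := x1 l; have := x1 i0.
  move: `|x i| `|x l| `|x i0| c x0c => u v y c yc y1 v1 u1.
  have : 0 <= (u * c - v * c) ^+ 2 by apply: sqr_ge0.
  have : 0 <= (u * v * c) * (c - y) by rewrite !mulr_ge0 //; lra.
  nra.
have E : (esym_gen sq setT)`_k.+2 <= M ^+ 2 + 2 * N * M.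
  have := esym_gen_sqr_subtop x setT; rewrite cardsT cI coefXMS => ->; rewrite !coefXMS.
  apply: lerD.
    by rewrite -real_normK ?num_real // lerXn2r ?nnegrE // (le_trans _ e2M).
  apply: le_trans (ler_norm _) _; rewrite normrN !normrM ger0_norm //.
  by rewrite ler_pM ?mulr_ge0.
(* From 2 N (y - M) <= M^2 and N >= y, the ratio y / M is at most the positive root (1 + sqrt 3)/2
   of 2 t (t - 1) = 1. The number 7/5 lies between this root and alpha_3 = sqrt 2. *)
rewrite leNgt; apply/negP => lt.
have M0 : 0 <= M by apply: le_trans e1M.
have := x1 i0; move: `|x i0| N {NE} Nx0 amgm E lt => y N Nx0 amgm E lt y1.
have : 0 <= M * (N - y) by rewrite mulr_ge0 //; lra.
have : 0 <= N * (5 * y - 7 * M) by rewrite mulr_ge0 //; lra.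
have : 0 <= M * (5 * y - 7 * M) by rewrite mulr_ge0 //; lra.
nra.
Qed.

End RealRoots.

(** * Comparison of the constants with [alpha] *)

Section AlphaBounds.

Variable R : realType.

Lemma sqrt2_ge75 : 7 / 5 <= 2 `^ (1 / 2) :> R.
Proof.
rewrite div1r powR12_sqrt // -[leLHS]ger0_norm; last by lra.
by rewrite -sqrtr_sqr ler_wsqrtr //; lra.
Qed.

Lemma pow2_le_alpha (n m : nat) : (6 <= n)%N ->
  (4 * m + 18 <= n ^ 2 + 2 * n)%N -> 2 ^+ m <= alpha R n.
Proof.
move=> n6 le_mn.
have -> : alpha R n = 2 `^ ((n%:R ^+ 2 + 2 * n%:R - 18) / 4).
  by move: n6 {le_mn}; do 6!case: n => [|n] //.
rewrite -powR_mulrn // ler_powR ?ler1n // ler_pdivlMr // lerBrDr.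
by move: le_mn; rewrite -(ler_nat R) (natrD _ (4 * m)) (natrD _ (n ^ 2)) natrX (natrM _ 4) (natrM _ 2) mulrC.
Qed.

(** With j = k+1, the disjunction excludes j = n-2 for n = 4 and 5, where the inequality fails: 13 >
    3 sqrt 2 and 41 > 15 sqrt 2. *)
Lemma binomial_le_alpha (n k : nat) : (4 <= n)%N -> (k.+3 < n)%N || (6 <= n)%N ->
  (k.+3 <= n)%N -> (k.+2 * 'C(n, k)).+1%:R <= alpha R n.
Proof.
move=> n4; have [n6 _ lekn|n6] := leqP 6 n; last first.
  rewrite orbF => lt_kn _; have s2 := sqrt2_ge75.
  have {n4 n6} [En|En] : n = 4%N \/ n = 5%N by lia.
    by subst n; case: k lt_kn => // _; rewrite bin0 /alpha; lra.
  subst n; case: k lt_kn => [_|[_|//]]; rewrite ?bin0 ?bin1 /alpha; lra.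
(* For n >= 7, the bounds C(n,k) <= 2^n and n <= 2^(n-4) give at most 2^(2n-3). This exponent is too
   large for n = 6, where each k is checked against 2^7. *)
have [n7|] := ltnP 6 n.
  apply: le_trans (_ : 2 ^+ (2 * n - 3) <= _); last first.
    by apply: pow2_le_alpha => //; nia.
  rewrite -natrX ler_nat.
  have binn : ('C(n, k) <= 2 ^ n)%N.
    rewrite -[n in 'C(n, _)]card_ord -card_draws -[n in (2 ^ n)%N]card_ord.
    by rewrite -cardsT -card_powerset subset_leq_card // powersetT subsetT.
  have [m En] : exists m, n = (m + 7)%N by exists (n - 7)%N; lia.
  have n4p : (n <= 2 ^ (m + 3))%N.
    by rewrite En; elim: m {En} => // m; rewrite !addSn expnS; lia.
  have -> : (2 * n - 3 = n + (m + 3) + 1)%N by lia.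
  rewrite addn1 expnS expnD.
  have := leq_mul (leq_trans (leq_trans (leqnSn _) lekn) n4p) binn.
  have : (0 < 2 ^ n * 2 ^ (m + 3))%N by rewrite muln_gt0 !expn_gt0.
  by rewrite [(2 ^ (m + 3) * _)%N]mulnC; lia.
move=> n6'; have {n6 n6' n4} E : n = 6%N by lia.
subst n.
apply: le_trans (_ : 2 ^+ 7 <= _); last exact: pow2_le_alpha.
rewrite -natrX ler_nat.
by case: k lekn => [|[|[|[|k]]]].
Qed.

Lemma alpha_ge75 n : (3 <= n)%N -> 7 / 5 <= alpha R n.
Proof.
have := sqrt2_ge75.
case: n => [|[|[|[|[|[|n]]]]]] //= s2 _; try lra.
by apply: le_trans (@pow2_le_alpha n.+4.+2 3 _ _); [lra | | nia].
Qed.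

End AlphaBounds.

(** * Assembly: case analysis on j *)

Theorem theorem1 (R : realType) (n : nat) (hn : (2 <= n)%N)
    (Q : {poly int}) (a : nat -> int) (x : 'I_n -> int)
    (hcoef : Q = 'X^n + \sum_(1 <= k < n.+1) a k *: 'X^(n - k))
    (hroot : Q = \prod_(i < n) ('X - (x i)%:P))
    (hx : forall i : 'I_n, x i != 0)
    (j : nat) (hj : (1 <= j <= n - 1)%N) (M : R)
    (hM : (maxn `|a j| `|a j.+1|)%:R <= M) :
  (\max_(i < n) `|x i|)%N%:R <= alpha R n * M.
Proof.
have x1 i : 1 <= `|x i| by rewrite -gtz0_ge1 normr_gt0.
pose p := esym_gen x setT.
have absa k : (1 <= k <= n)%N -> `|a k| = `|p`_k|.
  move=> /andP[k0 kn].
  have <- : Q`_(n - k) = a k.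
    rewrite hcoef coefD coefXn ltn_eqF ?add0r; last by lia.
    rewrite coef_sumMXn big_mkcond (bigD1_seq k) ?iota_uniq ?mem_index_iota //=.
      rewrite eqxx big1_seq ?addr0 // => i /andP[neq_ik].
      by rewrite mem_index_iota => hi; case: eqP => // hik; lia.
    by rewrite k0 ltnS.
  have := @coef_prod_linear_factors _ _ x k; rewrite card_ord hroot => -> //.
  by rewrite normrM normrX normrN1 expr1n mul1r.
set m := maxn _ _ in hM.
have aj : `|p`_j| <= m%:Z.
  by rewrite -absa; [rewrite -abszE lez_nat leq_maxl | lia].
have aj1 : `|p`_j.+1| <= m%:Z.
  by rewrite -absa; [rewrite -abszE lez_nat leq_maxr | lia].
have n0 : (0 < #|'I_n|)%N by rewrite card_ord; lia.
have [i0 ->] := bigop.eq_bigmax (fun i => `|x i|)%N n0.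
(* The root bounds are integer inequalities in m, and m <= M; in each case it remains to compare a
   constant c with [alpha]. *)
suff [c [c0 le_c leM]] :
    exists c : R, [/\ 0 <= c, c <= alpha R n & (`|x i0|)%N%:R <= c * m%:R].
  apply: le_trans leM _; apply: le_trans (ler_wpM2l c0 hM) _.
  by rewrite ler_wpM2r // (le_trans _ hM).
have [ejn|jn1] := eqVneq j n.-1.
  exists 1; split=> //.
    move: hn; rewrite leq_eqVlt => /predU1P[<- //|/(alpha_ge75 R)]; lra.
  rewrite mul1r ler_nat -lez_nat abszE (root_le_top _ x1) // card_ord.
  by move: aj1; rewrite (_ : j.+1 = n) //; lia.
(* Here j >= 1 forces n >= 3, so 7/5 is below [alpha]. *)
have [ejn|jn2] := eqVneq j n.-2.
  have n3 : (3 <= n)%N by lia.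
  exists (7 / 5); split; [lra | exact: alpha_ge75 |].
  have cI : #|'I_n| = j.-1.+3 by rewrite card_ord; lia.
  have jS : j = j.-1.+1 by lia.
  have := root_le_subtop (M := m%:Z) i0 x1 cI.
  rewrite -!jS => /(_ aj aj1); rewrite -abszE => le5.
  have : (5 * `|x i0| <= 7 * m)%N by lia.
  rewrite -(ler_nat R) !natrM; lra.
have jS : j = j.-1.+1 by lia.
exists (j.+1 * 'C(n, j.-1)).+1%:R; split; first by [].
  by rewrite {1}jS binomial_le_alpha //; lia.
rewrite -natrM ler_nat -lez_nat abszE.
have := @root_le_binomial _ _ x j.-1 m%:Z i0 x1; rewrite card_ord -!jS.
rewrite PoszM natz; apply=> //; lia.
Qed.
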